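(* (Extended Cartan Formula) Let $M$ be a smooth manifold, $\alpha\in\Omega^r(M)$ and $p\in\mathfrak X^s(M)$. Then $$p\lrcorner\, d\alpha-(-1)^s d(p\lrcorner\,\alpha)=(\lrcorner\,\mathcal L)_P\alpha-L(P)\lrcorner\,\alpha$$ for any $P\in\Lambda^s_{\mathbb R}\mathfrak X(M)$ projecting to $p$.
   Context: $\mathfrak X^s(M)=\Gamma(\Lambda^sTM)$ is the space of multi-vector fields of degree $s\geqslant1$, and for $q=X_1\wedge\dots\wedge X_s$, $(q\lrcorner\,\beta)(Y_1,\dots,Y_{r-s})=\beta(X_1,\dots,X_s,Y_1,\dots,Y_{r-s})$ for an $r$-form $\beta$ (zero if $s>r$), extended linearly. $\Lambda^s_{\mathbb R}\mathfrak X(M)$ is the $s$th exterior power of the space of vector fields $\mathfrak X(M)$ regarded as a vector space over $\mathbb R$, with wedge product denoted $\curlywedge$. The $\mathbb R$-linear projection $\Lambda^s_{\mathbb R}\mathfrak X(M)\to\mathfrak X^s(M)$ sends $Q=X_1\curlywedge\dots\curlywedge X_s$ to $X_1\wedge\dots\wedge X_s$; contraction with an element of $\Lambda^s_{\mathbb R}\mathfrak X(M)$ means contraction with its projection. For such $Q$ write $Q_{\wedge i}=(-1)^{i-1}X_1\curlywedge\dots\curlywedge\widehat{X_i}\curlywedge\dots\curlywedge X_s$ and, for $i<j$, $Q_{\wedge ij}=(Q_{\wedge i})_{\wedge j}=(-1)^{i+j}X_1\curlywedge\dots\curlywedge\widehat{X_i}\curlywedge\dots\curlywedge\widehat{X_j}\curlywedge\dots\curlywedge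 X_s$ (the sign for removing $X_j$ uses its original index $j$). Define $$(\lrcorner\,\mathcal L)_Q\alpha=\sum_{i=1}^sQ_{\wedge i}\lrcorner\,\mathcal L_{X_i}\alpha,\qquad L(Q)=\sum_{1\leqslant i<j\leqslant s}[X_i,X_j]\curlywedge Q_{\wedge ij},$$ where $\mathcal L_X$ is the Lie derivative, and extend $\mathbb R$-linearly to $\Lambda^s_{\mathbb R}\mathfrak X(M)$. *)

(* Defs.v *)
From HB Require Import structures.
From mathcomp Require Import all_boot all_order all_algebra generic_quotient.
From mathcomp Require Import all_classical all_reals topology normedtype landau.
From mathcomp Require Import derive.
Set Implicit Arguments.
Unset Strict Implicit.
Unset Printing Implicit Defensive.
Import Order.TTheory GRing.Theory Num.Theory numFieldNormedType.Exports.
Local Open Scope ring_scope.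
Local Open Scope classical_set_scope.
Local Open Scope quotient_scope.

Section Smooth.
Variable R : realType.
Section Ck.
Variables V W : normedModType R.

(* C^k on an open set U: all iterated directional derivatives up to order k
   exist and are continuous on U. *)
Fixpoint Ck (k : nat) (U : set V) (f : V -> W) : Prop :=
  if k is k'.+1 then
    {in U, forall x, differentiable f x} /\ forall v, Ck k' U ('D_v f)
  else {in U, continuous f}.

Definition smooth_on U f := forall k, Ck k U f.
End Ck.

Section Near.
Variables V W : normedModType R.
Lemma near_eq_differentiable (f g : V -> W) (a : V) :
  (\near a, f a = g a) -> differentiable f a -> differentiable g a.
Proof.
move=> fg df.
have E : g \o shift a = cst (g a) + 'd f a +o_ 0 id.
  apply/eqaddoP => e e0; have /eqaddoP/(_ e e0) := diff_locally df.
  have fga := nbhs_singleton fg.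
  have : \forall h \near 0, f (h + a) = g (h + a).
    by move: fg; rewrite (near_shift 0) subr0.
  move=> H1 H2; near=> h.
  have A : `|(f \o shift a - (cst (f a) + 'd f a)) h| <= e * `|id h| by near: h.
  have B : f (h + a) = g (h + a) by near: h.
  by move: A; rewrite !fctE /= B fga.
have [dc _] := (diff_locallyP _ _).1 df.
by apply/diff_locallyP; rewrite (diff_unique dc E).
Unshelve. all: by end_near. Qed.

Lemma Ck_eq k (U : set V) (f g : V -> W) : open U ->
  (forall x, U x -> f x = g x) -> Ck k U f -> Ck k U g.
Proof.
elim: k f g => [|k IH] f g oU fg /=.
  move=> cf x; rewrite inE => Ux; have := cf x; rewrite inE => /(_ Ux) cfx.
  rewrite /continuous_at -(fg _ Ux); apply: cvg_trans cfx.
  apply: near_eq_cvg; near=> y; apply/fg; near: y; exact: open_nbhs_nbhs.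
move=> [df Df]; split.
  move=> x xU; apply: (near_eq_differentiable (f := f)); last exact: df.
  near=> y; apply/fg; near: y; apply: open_nbhs_nbhs; split => //; by rewrite inE in xU.
move=> v; apply: IH (Df v) => // x Ux.
by apply: near_eq_derive; near=> y; apply/fg; near: y; exact: open_nbhs_nbhs.
Unshelve. all: by end_near. Qed.

Lemma CkS k (U : set V) (f : V -> W) : Ck k.+1 U f -> Ck k U f.
Proof.
elim: k f => [|k IH] f.
  by case=> df _ x /df; exact: differentiable_continuous.
by case=> df Df; split=> // v; exact: IH (Df v).
Qed.

Lemma CkD k (U : set V) (f g : V -> W) : open U ->
  Ck k U f -> Ck k U g -> Ck k U (f + g).
Proof.
move=> oU; elim: k f g => [|k IH] f g.
  by move=> cf cg x xU; apply: continuousD; [exact: cf|exact: cg].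
move=> [df Df] [dg Dg]; split.
  by move=> x xU; apply: differentiableD; [exact: df|exact: dg].
move=> v; apply: Ck_eq (IH _ _ (Df v) (Dg v)) => // x Ux.
have xU : x \in U by rewrite inE.
by rewrite deriveD//; apply: diff_derivable; [exact: df|exact: dg].
Qed.

Lemma CkZ k (U : set V) a (f : V -> W) : open U ->
  Ck k U f -> Ck k U (a *: f).
Proof.
move=> oU; elim: k f => [|k IH] f.
  by move=> cf x xU; apply: continuousZl_tmp; exact: cf.
move=> [df Df]; split.
  by move=> x xU; apply: differentiableZ; exact: df.
move=> v; apply: Ck_eq (IH _ (Df v)) => // x Ux.
have xU : x \in U by rewrite inE.
by rewrite deriveZ//; apply: diff_derivable; exact: df.
Qed.

Lemma Ck_cst k (U : set V) (w : W) : Ck k U (cst w).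
Proof.
elim: k w => [|k IH] w /=.
  by move=> x _; exact: cst_continuous.
split=> [x _|v]; first exact: differentiable_cst.
by rewrite (_ : 'D_v (cst w) = cst 0)//; apply/funext => x; rewrite derive_cst.
Qed.

Lemma Ck_sum k (U : set V) (I : Type) (r : seq I) (F : I -> V -> W) : open U ->
  (forall i, Ck k U (F i)) -> Ck k U (\sum_(i <- r) F i).
Proof.
move=> oU FC; elim/big_ind : _ => //; first exact: Ck_cst.
by move=> f g; exact: CkD.
Qed.

Lemma CkZl k (U : set V) (f : V -> R) (w : W) : open U ->
  Ck k U f -> Ck k U (fun x => f x *: w).
Proof.
move=> oU; elim: k f => [|k IH] f.
  by move=> cf x xU; apply: continuousZr_tmp; exact: cf.
move=> [df Df]; split.
  by move=> x xU; apply: differentiableZl; exact: df.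
move=> v; apply: Ck_eq (IH _ (Df v)) => // x Ux.
have xU : x \in U by rewrite inE.
have dx := df x xU; rewrite !deriveE//; last exact: differentiableZl.
by rewrite diffZl.
Qed.
End Near.

Section Scalar.
Variables V : normedModType R.
Lemma CkM k (U : set V) (f g : V -> R) : open U ->
  Ck k U f -> Ck k U g -> Ck k U (f * g).
Proof.
move=> oU; elim: k f g => [|k IH] f g.
  by move=> cf cg x xU; apply: continuousM; [exact: cf|exact: cg].
move=> [df Df] [dg Dg]; split.
  by move=> x xU; apply: differentiableM; [exact: df|exact: dg].
move=> v.
have Cf : Ck k U f by apply: CkS; split.
have Cg : Ck k U g by apply: CkS; split.
apply: Ck_eq (CkD oU (IH _ _ Cf (Dg v)) (IH _ _ Cg (Df v))) => // x Ux.
have xU : x \in U by rewrite inE.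
by rewrite deriveM//; apply: diff_derivable; [exact: df|exact: dg].
Qed.

Lemma Ck_coord k m (U : set V) (f : V -> 'rV[R]_m) : open U ->
  Ck k U f <-> forall j, Ck k U (fun x => f x 0 j).
Proof.
move=> oU; split.
  move=> + j; elim: k f => [|k IH] f.
    move=> cf x xU; apply: (@continuous_comp _ _ _ f (fun w : 'rV_m => w 0 j)).
      exact: cf.
    exact: coord_continuous.
  move=> [df Df]; split.
    move=> x xU; apply: (@differentiable_comp _ _ _ _ f (fun w : 'rV_m => w 0 j)).
      exact: df.
    exact: differentiable_coord.
  move=> v; apply: Ck_eq (IH _ (Df v)) => // x Ux.
  have xU : x \in U by rewrite inE.
  by rewrite derive_mx ?mxE//; apply: diff_derivable; exact: df.
move=> fC.
have -> : f = \sum_(j < m) (fun x => f x 0 j *: delta_mx 0 j).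
  apply/funext => x; rewrite [LHS]row_sum_delta fct_sumE.
  by [].
by apply: Ck_sum => // j; exact: CkZl.
Qed.
End Scalar.

End Smooth.

Section Schwarz.
Variable R : realType.

Lemma derive_comp (U V W : normedModType R) (f : U -> V) (g : V -> W) x u :
  differentiable f x -> differentiable g (f x) ->
  'D_u (g \o f) x = 'D_('D_u f x) g (f x).
Proof.
move=> df dg; rewrite !deriveE//; last exact: differentiable_comp.
by rewrite diff_comp.
Qed.

Lemma itv_oo_cc (a b x : R) : x \in `]a, b[%R -> x \in `[a, b]%R.
Proof. by rewrite !in_itv/= => /andP[/ltW-> /ltW->]. Qed.

Variable V : normedModType R.
Lemma line_mvt (f : V -> R) p w (h : R) : 0 < h ->
  (forall t, t \in `[0, h]%R -> differentiable f (p + t *: w)) ->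
  exists2 t, t \in `]0, h[%R & f (p + h *: w) - f p = h * 'D_w f (p + t *: w).
Proof.
move=> h0 df.
pose l (t : R) := p + t *: w.
have dl t : is_diff t l ( *:%R^~ w).
  have H : is_diff t (cst p + *:%R^~ w) (0 + *:%R^~ w) by exact: is_diffD.
  by apply: is_diff_eq H _; rewrite add0r.
have Dl t : 'D_1 l t = w by rewrite deriveE// diff_val scale1r.
have dfl t : t \in `[0, h]%R -> differentiable (f \o l) t.
  by move=> th; apply: differentiable_comp => //; exact: df.
have := @MVT _ (f \o l) (fun t => 'D_w f (l t)) 0 h h0.
case.
- move=> t th; have th' : t \in `[0, h]%R by exact: itv_oo_cc.
  split; first by apply: diff_derivable; exact: dfl.
  rewrite derive_comp//; last exact: df.
  by rewrite Dl.
- apply: continuous_in_subspaceT => t; rewrite inE => th.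
  by apply: differentiable_continuous; exact: dfl.
- move=> t th; rewrite subr0 /= /l scale0r addr0 => E.
  by exists t => //; rewrite E mulrC.
Qed.

Lemma schwarz_aux (U : set V) (f : V -> R) x u v (h : R) : 0 < h ->
  Ck 2 U f ->
  (forall s t, s \in `[0, h]%R -> t \in `[0, h]%R -> U (x + s *: u + t *: v)) ->
  exists s t, [/\ s \in `[0, h]%R, t \in `[0, h]%R &
   f (x + h *: u + h *: v) - f (x + h *: v) - (f (x + h *: u) - f x) =
   h * (h * 'D_u ('D_v f) (x + s *: u + t *: v))].
Proof.
move=> h0 [df Df] Uxy.
pose phi y := f (y + h *: u) - f y.
have h_h : h \in `[0, h]%R by rewrite in_itv/= lexx ltW.
have z_h : 0 \in `[0, h]%R by rewrite in_itv/= lexx ltW.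
have dfs s t : s \in `[0, h]%R -> t \in `[0, h]%R -> differentiable f (x + s *: u + t *: v).
  by move=> sh th; apply: df; rewrite inE; exact: Uxy.
have dsh y : is_diff y (fun y : V => y + h *: u) id.
  have H : is_diff y (id + cst (h *: u)) (id + 0) by exact: is_diffD.
  by apply: is_diff_eq H _; rewrite addr0.
have Dsh y w : 'D_w (fun y : V => y + h *: u) y = w by rewrite deriveE// diff_val.
have d1 t : t \in `[0, h]%R -> differentiable f (x + t *: v).
  by move=> th; have := dfs 0 t z_h th; rewrite scale0r addr0.
have d2 t : t \in `[0, h]%R -> differentiable f (x + t *: v + h *: u).
  by move=> th; have := dfs h t h_h th; rewrite addrAC.
have d3 t : t \in `[0, h]%R ->
    differentiable (fun y : V => f (y + h *: u)) (x + t *: v).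
  by move=> th; apply: (@differentiable_comp _ _ _ _ (fun y : V => y + h *: u) f) => //; exact: d2.
have dphi t : t \in `[0, h]%R -> differentiable phi (x + t *: v).
  move=> th; apply: differentiableB; [exact: d3|exact: d1].
have [t th Et] := line_mvt h0 dphi.
have {}th : t \in `[0, h]%R by exact: itv_oo_cc.
have Dphi : 'D_v phi (x + t *: v) = 'D_v f (x + t *: v + h *: u) - 'D_v f (x + t *: v).
  rewrite deriveB; [|exact/diff_derivable/d3|exact/diff_derivable/d1].
  congr (_ - _); rewrite (@derive_comp _ _ _ (fun y : V => y + h *: u) f)//; last exact: d2.
  by rewrite Dsh.
have dDf s : s \in `[0, h]%R -> differentiable ('D_v f) (x + t *: v + s *: u).
  move=> sh; case: (Df v) => + _; apply.
  by rewrite inE addrAC; exact: Uxy.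
have [s sh Es] := line_mvt h0 dDf.
exists s, t; split => //; first exact: itv_oo_cc.
rewrite [X in 'D_u _ X]addrAC -Es -Dphi -Et /phi.
by rewrite [X in f X - f (x + h *: v)]addrAC.
Qed.

Lemma schwarz (U : set V) (f : V -> R) x u v : open U -> U x -> Ck 2 U f ->
  'D_u ('D_v f) x = 'D_v ('D_u f) x.
Proof.
move=> oU Ux C2.
have xU : x \in U by rewrite inE.
have cuv a b : {for x, continuous ('D_a ('D_b f))}.
  by case: C2 => _ /(_ b)[_ /(_ a)]; apply.
apply/eqP; rewrite -subr_eq0 -normr_le0; apply/ler_addgt0Pr => e e0.
rewrite add0r.
have e2 : 0 < e / 2 by rewrite divr_gt0.
have A a b : \forall y \near x, U y /\ `|'D_a ('D_b f) x - 'D_a ('D_b f) y| < e / 2.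
  have Hc : \forall y \near x, `|'D_a ('D_b f) x - 'D_a ('D_b f) y| < e / 2.
    by move/cvgrPdist_lt : (cuv a b); exact.
  near=> y; split; first by near: y; exact: open_nbhs_nbhs.
  by near: y; exact: Hc.
have [d d0 Hd] : exists2 d : R, 0 < d & forall y, `|x - y| < d ->
  [/\ U y, `|'D_u ('D_v f) x - 'D_u ('D_v f) y| < e / 2 &
     `|'D_v ('D_u f) x - 'D_v ('D_u f) y| < e / 2].
  have /nbhs_ballP[d /= d0 Hd] : \forall y \near x,
    [/\ U y, `|'D_u ('D_v f) x - 'D_u ('D_v f) y| < e / 2 &
     `|'D_v ('D_u f) x - 'D_v ('D_u f) y| < e / 2].
    by apply: filterS2 (A u v) (A v u) => y [Uy ?] [_ ?].
  by exists d => // y xy; apply: Hd; rewrite -ball_normE.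
pose h := d / (`|u| + `|v| + 1) / 2.
have c0 : 0 < `|u| + `|v| + 1 by rewrite ltr_wpDl// addr_ge0.
have h0 : 0 < h by rewrite !divr_gt0.
have Hn s t : s \in `[0, h]%R -> t \in `[0, h]%R -> `|x - (x + s *: u + t *: v)| < d.
  rewrite !in_itv/= => /andP[s0 sh] /andP[t0 th].
  rewrite -addrA opprD addrA subrr add0r normrN.
  apply: (le_lt_trans (ler_normD _ _)); rewrite !normrZ !ger0_norm//.
  apply: (@le_lt_trans _ _ (h * (`|u| + `|v| + 1))).
    rewrite !mulrDr mulr1 -[leLHS]addr0 !lerD//; last exact: ltW.
    - by rewrite ler_wpM2r.
    - by rewrite ler_wpM2r.
  rewrite /h mulrAC divfK ?gt_eqF// ltr_pdivrMr// ltr_pMr//.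
  by rewrite ltr1n.
have [s [t [sh th E1]]] : exists s t, [/\ s \in `[0, h]%R, t \in `[0, h]%R &
   f (x + h *: u + h *: v) - f (x + h *: v) - (f (x + h *: u) - f x) =
   h * (h * 'D_u ('D_v f) (x + s *: u + t *: v))].
  apply: (schwarz_aux (U := U)) => // s t sh th.
  by have [] := Hd _ (Hn s t sh th).
have [s' [t' [sh' th' E2]]] : exists s t, [/\ s \in `[0, h]%R, t \in `[0, h]%R &
   f (x + h *: v + h *: u) - f (x + h *: u) - (f (x + h *: v) - f x) =
   h * (h * 'D_v ('D_u f) (x + s *: v + t *: u))].
  apply: (schwarz_aux (U := U)) => // s' t' sh' th'.
  by rewrite addrAC; have [] := Hd _ (Hn t' s' th' sh').
have E : 'D_u ('D_v f) (x + s *: u + t *: v) = 'D_v ('D_u f) (x + s' *: v + t' *: u).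
  apply: (mulfI (lt0r_neq0 h0)); apply: (mulfI (lt0r_neq0 h0)).
  apply: (etrans (esym E1)); apply: etrans E2.
  by rewrite [in RHS](addrAC x) !opprD addrACA.
have [_ H1 _] := Hd _ (Hn _ _ sh th).
rewrite [x + _ + _]addrAC in E.
have [_ _ H2] := Hd _ (Hn _ _ th' sh').
rewrite [x + _ + _]addrAC in H2.
rewrite (splitr e); apply: le_trans (lerD (ltW H1) (ltW H2)).
rewrite [x + s *: u + _]addrAC E [X in _ <= _ + X]distrC.
by apply: le_trans (ler_normD _ _); rewrite addrA subrK.
Unshelve. all: by end_near. Qed.
End Schwarz.

Section Alternating.
Variables (K : fieldType) (V W : lmodType K).

(* A k-linear alternating map V^k -> W, presented as a function on lists of
   vectors which vanishes on the lists of length other than k; no casts between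
   V^(s + t) and V^s * V^t are then needed. *)
Definition alternating_form (k : nat) (f : seq V -> W) : Prop :=
  [/\ forall (u w : seq V) (a : K) (x y : V),
        f (u ++ (a *: x + y) :: w) = a *: f (u ++ x :: w) + f (u ++ y :: w),
      forall (u v w : seq V) (x : V), f (u ++ x :: v ++ x :: w) = 0
    & forall u : seq V, size u != k -> f u = 0].

(* A formal linear combination of s-tuples is a list of pairs
   (coefficient, tuple); this is its image under the linear extension of f. *)
Definition feval (f : seq V -> W) (F : seq (K * seq V)) : W :=
  \sum_(t <- F) t.1 *: f t.2.

End Alternating.

Section ExteriorPower.
Variables (K : fieldType) (V : lmodType K) (s : nat).

(* Two formal combinations of tuples are identified iff no alternating s-linear
   map, with values in any vector space W, tells them apart. The quotient is
   therefore the s-th exterior power of V, with its universal property; tuples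
   of length other than s become 0. *)
Definition ext_rel (F G : seq (K * seq V)) : bool :=
  `[< forall (W : lmodType K) (f : seq V -> W),
        alternating_form s f -> feval f F = feval f G >].

Lemma ext_rel_refl : reflexive ext_rel. Proof. by move=> F; apply/asboolP. Qed.
Lemma ext_rel_sym : symmetric ext_rel.
Proof. by move=> F G; apply/asboolP/asboolP => H W f /H. Qed.
Lemma ext_rel_trans : transitive ext_rel.
Proof.
move=> F G H /asboolP FG /asboolP GH; apply/asboolP => W f fA.
by rewrite FG// GH.
Qed.

Canonical ext_equiv := EquivRel ext_rel ext_rel_refl ext_rel_sym ext_rel_trans.
Definition extpow := {eq_quot ext_equiv}.
HB.instance Definition _ := Choice.on extpow.
HB.instance Definition _ := EqQuotient.on extpow.

Lemma ext_eqP (F G : seq (K * seq V)) :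
  (forall (W : lmodType K) (f : seq V -> W),
     alternating_form s f -> feval f F = feval f G) <-> \pi_extpow F = \pi_extpow G.
Proof. by split=> [H|/eqmodP/asboolP//]; apply/eqmodP/asboolP. Qed.

Lemma feval_repr (W : lmodType K) (f : seq V -> W) F :
  alternating_form s f -> feval f (repr (\pi_extpow F)) = feval f F.
Proof. by move: W f; apply/ext_eqP; rewrite reprK. Qed.

Lemma feval_cat (W : lmodType K) (f : seq V -> W) F G :
  feval f (F ++ G) = feval f F + feval f G.
Proof. by rewrite /feval big_cat. Qed.

Definition fscale (a : K) (F : seq (K * seq V)) := [seq (a * t.1, t.2) | t <- F].

Lemma feval_scale (W : lmodType K) (f : seq V -> W) a F :
  feval f (fscale a F) = a *: feval f F.
Proof.
by rewrite /feval big_map scaler_sumr; apply: eq_bigr => t _; rewrite scalerA.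
Qed.

Definition ext_zero : extpow := \pi_extpow [::].
Definition ext_add (P Q : extpow) : extpow := \pi_extpow (repr P ++ repr Q).
Definition ext_scale (a : K) (P : extpow) : extpow := \pi_extpow (fscale a (repr P)).
Definition ext_opp (P : extpow) : extpow := ext_scale (-1) P.

Lemma ext_ind (p : extpow -> Prop) : (forall F, p (\pi_extpow F)) -> forall P, p P.
Proof. by move=> H P; rewrite -(reprK P). Qed.

Lemma ext_addA : associative ext_add.
Proof.
by move=> P Q S; apply/ext_eqP => W f fA; rewrite !(feval_cat, feval_repr)// addrA.
Qed.
Lemma ext_addC : commutative ext_add.
Proof. by move=> P Q; apply/ext_eqP => W f fA; rewrite !feval_cat addrC. Qed.
Lemma ext_add0 : left_id ext_zero ext_add.
Proof.
elim/ext_ind => F; apply/ext_eqP => W f fA.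
by rewrite !(feval_cat, feval_repr)// /feval big_nil add0r.
Qed.
Lemma ext_addN : left_inverse ext_zero ext_opp ext_add.
Proof.
elim/ext_ind => F; apply/ext_eqP => W f fA.
rewrite !(feval_cat, feval_repr, feval_scale)// scaleN1r addNr.
by rewrite /feval big_nil.
Qed.
HB.instance Definition _ :=
  GRing.isZmodule.Build extpow ext_addA ext_addC ext_add0 ext_addN.

Lemma ext_scaleA a b P : ext_scale a (ext_scale b P) = ext_scale (a * b) P.
Proof.
by apply/ext_eqP => W f fA; rewrite !(feval_scale, feval_repr)// scalerA.
Qed.
Lemma ext_scale1 : left_id 1 ext_scale.
Proof.
elim/ext_ind => F; apply/ext_eqP => W f fA.
by rewrite !(feval_scale, feval_repr)// scale1r.
Qed.
Lemma ext_scaleDr : right_distributive ext_scale +%R.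
Proof.
move=> a P Q; apply/ext_eqP => W f fA.
by rewrite !(feval_scale, feval_repr, feval_cat)// scalerDr.
Qed.
Lemma ext_scaleDl P : {morph ext_scale^~ P : a b / a + b}.
Proof.
move=> a b; apply/ext_eqP => W f fA.
by rewrite !(feval_scale, feval_repr, feval_cat)// scalerDl.
Qed.
HB.instance Definition _ := GRing.Zmodule_isLmodule.Build K extpow
  ext_scaleA ext_scale1 ext_scaleDr ext_scaleDl.

Lemma ext_addE (P Q : extpow) : P + Q = \pi_extpow (repr P ++ repr Q). Proof. by []. Qed.
Lemma ext_scaleE a (P : extpow) : a *: P = \pi_extpow (fscale a (repr P)).
Proof. by []. Qed.

Definition wedge (u : seq V) : extpow := \pi_extpow [:: (1, u)].

(* The linear map on the exterior power with value f u on the decomposable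
   element wedge u. It is evaluated on a representative; for alternating f the
   choice is immaterial and the map is linear (ext_lift_pi, ext_lift_wedge,
   ext_lift_linear). *)
Definition ext_lift (W : lmodType K) (f : seq V -> W) (P : extpow) : W :=
  \sum_(t <- repr P | size t.2 == s) t.1 *: f t.2.

Lemma ext_lift_pi (W : lmodType K) (f : seq V -> W) F :
  alternating_form s f -> ext_lift f (\pi_extpow F) = feval f F.
Proof.
move=> fA; rewrite -(feval_repr F fA) /ext_lift /feval big_mkcond.
apply: eq_bigr => t _; case: ifPn => // st; case: fA => _ _ -> //.
by rewrite scaler0.
Qed.

Lemma ext_lift_wedge (W : lmodType K) (f : seq V -> W) u :
  alternating_form s f -> ext_lift f (wedge u) = f u.
Proof. by move=> fA; rewrite ext_lift_pi// /feval big_seq1 scale1r. Qed.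

Lemma ext_lift_linear (W : lmodType K) (f : seq V -> W) a P Q :
  alternating_form s f -> ext_lift f (a *: P + Q) = a *: ext_lift f P + ext_lift f Q.
Proof.
move=> fA; elim/ext_ind: P => F; elim/ext_ind: Q => G.
rewrite ext_addE ext_scaleE.
by rewrite ext_lift_pi// !(feval_cat, feval_repr, feval_scale)// !ext_lift_pi.
Qed.

Lemma wedge_alternating : alternating_form s wedge.
Proof.
split=> [u w a x y|u v w x|u us]; rewrite ?ext_addE ?ext_scaleE; apply/ext_eqP => W f [fL fA f0].
- rewrite !(feval_cat, feval_repr, feval_scale)//.
  by rewrite /feval !big_seq1 !scale1r fL.
- by rewrite /feval big_seq1 big_nil scale1r fA.
- by rewrite /feval big_seq1 big_nil scale1r f0.
Qed.

Lemma ext_lift_wedge_id P : ext_lift wedge P = P.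
Proof.
have wA := wedge_alternating; elim/ext_ind: P => F; rewrite ext_lift_pi//.
elim: F => [|t F IH]; first by rewrite /feval big_nil.
rewrite -cat1s feval_cat IH {1}/feval big_seq1 ext_addE ext_scaleE; apply/ext_eqP => W f fA.
by rewrite !(feval_cat, feval_repr, feval_scale)// /feval !big_seq1 scale1r.
Qed.

End ExteriorPower.

Section Flat.
Variables (R : realType) (n : nat).
Local Notation V := 'rV[R]_n.

Lemma derive_expand (W : normedModType R) (t : V -> W) z w : differentiable t z ->
  'D_w t z = \sum_(j < n) w 0 j *: 'D_(delta_mx 0 j) t z.
Proof.
move=> dt; rewrite deriveE// {1}[w]row_sum_delta linear_sum; apply: eq_bigr => j _.
by rewrite linearZ/= deriveE.
Qed.

Lemma derive_row (M : V -> V) z v i : derivable M z v ->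
  'D_v M z 0 i = 'D_v (fun y => M y 0 i) z.
Proof. by move=> dM; rewrite (derive_mx dM) mxE. Qed.

Lemma derive_derive_scalar (U : set V) (t : V -> R) (Y : V -> V) z u :
  open U -> U z -> Ck 2 U t -> differentiable Y z ->
  'D_u (fun y => 'D_(Y y) t y) z =
  'D_('D_u Y z) t z + 'D_u ('D_(Y z) t) z.
Proof.
move=> oU Uz C2 dY; have zU : z \in U by rewrite inE.
have [dt Dt] := C2.
have dj w : derivable ('D_w t) z u.
  by apply: diff_derivable; case: (Dt w) => + _; exact.
have dYj j : derivable (fun y => Y y 0 j) z u.
  by have := diff_derivable (v := u) dY => /derivable_mxP /(_ 0 j).
have ex w : forall y, U y -> 'D_w t y = \sum_(j < n) w 0 j *: 'D_(delta_mx 0 j) t y.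
  by move=> y Uy; apply: derive_expand; apply: dt; rewrite inE.
have -> : 'D_u (fun y => 'D_(Y y) t y) z =
    'D_u (\sum_(j < n) ((fun y => Y y 0 j) * 'D_(delta_mx 0 j) t)) z.
  apply: near_eq_derive; near=> y.
  rewrite ex//; last by near: y; exact: open_nbhs_nbhs.
  by rewrite fct_sumE.
have -> : 'D_u ('D_(Y z) t) z =
    'D_u (\sum_(j < n) (Y z 0 j *: 'D_(delta_mx 0 j) t)) z.
  apply: near_eq_derive; near=> y.
  rewrite ex//; last by near: y; exact: open_nbhs_nbhs.
  by rewrite fct_sumE.
rewrite derive_sum; last by move=> j; exact: derivableM.
rewrite derive_sum; last by move=> j; exact: derivableZ.
rewrite ex// -big_split; apply: eq_bigr => j _ /=.
rewrite (deriveM (dYj j) (dj _)) (deriveZ _ (dj _)) addrC; congr (_ + _).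
rewrite -(derive_row j (diff_derivable (v := u) dY)).
by rewrite /GRing.scale/= mulrC.
Unshelve. all: by end_near. Qed.

Lemma derive_derive (U : set V) (T : V -> V) (Y : V -> V) z u :
  open U -> U z -> Ck 3 U T -> differentiable Y z ->
  'D_u (fun y => 'D_(Y y) T y) z =
  'D_('D_u Y z) T z + 'D_u ('D_(Y z) T) z.
Proof.
move=> oU Uz C3 dY.
have C2 : Ck 2 U T := CkS C3.
have cT i : Ck 2 U (fun y => T y 0 i) by exact: (Ck_coord 2 T oU).1.
have dT y w : U y -> derivable T y w.
  by move=> Uy; apply: diff_derivable; case: C2 => + _; apply; rewrite inE.
have DT w : derivable ('D_w T) z u.
  apply: diff_derivable; case: C2 => _ /(_ w)[+ _]; apply; rewrite inE//.
have dYT : derivable (fun y => 'D_(Y y) T y) z u.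
  apply/derivable_mxP => a i; rewrite (ord1 a).
  have : {near z, (\sum_(j < n) ((fun y => Y y 0 j) * (fun y => 'D_(delta_mx 0 j) T y 0 i))) =1
      (fun y => 'D_(Y y) T y 0 i)}.
    near=> y.
    rewrite derive_expand; last first.
      case: C2 => + _; apply; rewrite inE; near: y; exact: open_nbhs_nbhs.
    by rewrite fct_sumE summxE; apply: eq_bigr => j _; rewrite mxE.
  move/near_eq_derivable; apply; apply: derivable_sum => j; apply: derivableM.
    by have := diff_derivable (v := u) dY => /derivable_mxP /(_ 0 j).
  by have := DT (delta_mx 0 j) => /derivable_mxP /(_ 0 i).
apply/rowP => i; rewrite (derive_row i dYT) [RHS]mxE.
have -> : 'D_u (fun y => 'D_(Y y) T y 0 i) z =
   'D_u (fun y => 'D_(Y y) (fun y => T y 0 i) y) z.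
  apply: near_eq_derive; near=> y.
  apply: derive_row; apply: dT; near: y; exact: open_nbhs_nbhs.
rewrite (derive_derive_scalar _ oU Uz (cT i) dY); congr (_ + _).
  by rewrite (derive_row i (dT _ _ Uz)).
rewrite (derive_row i (DT _)); apply: near_eq_derive; near=> y.
by apply/esym/derive_row; apply: dT; near: y; exact: open_nbhs_nbhs.
Unshelve. all: by end_near. Qed.

Lemma schwarz_row (U : set V) (T : V -> V) z u v :
  open U -> U z -> Ck 3 U T -> 'D_u ('D_v T) z = 'D_v ('D_u T) z.
Proof.
move=> oU Uz C3; have C2 : Ck 2 U T := CkS C3.
have cT i : Ck 2 U (fun y => T y 0 i) by exact: (Ck_coord 2 T oU).1.
have dT y w : U y -> derivable T y w.
  by move=> Uy; apply: diff_derivable; case: C2 => + _; apply; rewrite inE.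
have DT a w : derivable ('D_w T) z a.
  apply: diff_derivable; case: C2 => _ /(_ w)[+ _]; apply; rewrite inE//.
have E a b i : 'D_a ('D_b T) z 0 i = 'D_a ('D_b (fun y => T y 0 i)) z.
  rewrite (derive_row i (DT _ _)); apply: near_eq_derive; near=> y.
  by apply: derive_row; apply: dT; near: y; exact: open_nbhs_nbhs.
apply/rowP => i; apply: (etrans (E u v i)); apply: (etrans _ (esym (E v u i))).
exact: (schwarz u v oU Uz (cT i)).
Unshelve. all: by end_near. Qed.

(* [X, Y] = DY(X) - DX(Y) in R^n *)
Definition flat_bracket (X Y : V -> V) z := 'D_(X z) Y z - 'D_(Y z) X z.

Lemma smooth_flat_bracket (U : set V) (X Y : V -> V) : open U ->
  smooth_on U X -> smooth_on U Y -> smooth_on U (flat_bracket X Y).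
Proof.
move=> oU sX sY k.
have H (F G : V -> V) : smooth_on U F -> smooth_on U G ->
    Ck k U (fun z => 'D_(F z) G z).
  move=> sF sG; apply/Ck_coord => // i.
  apply: (Ck_eq (f := \sum_(j < n) ((fun y => F y 0 j) *
      (fun y => 'D_(delta_mx 0 j) G y 0 i)))) => //.
    move=> z Uz; rewrite derive_expand; last by case: (sG 1%N) => + _; apply; rewrite inE.
    by rewrite fct_sumE summxE; apply: eq_bigr => j _; rewrite mxE.
  apply: Ck_sum => // j; apply: CkM => //.
    by apply: (Ck_coord k F oU).1; exact: sF.
  by apply: (Ck_coord k ('D_(delta_mx 0 j) G) oU).1; case: (sG k.+1) => _; exact.
rewrite (_ : flat_bracket X Y =
    (fun z => 'D_(X z) Y z) + -1 *: (fun z => 'D_(Y z) X z)).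
  by apply: CkD => //; [exact: H|apply: CkZ => //; exact: H].
by apply/funext => z; rewrite /flat_bracket !fctE scaleN1r.
Qed.

Lemma flat_bracket_pushforward (U : set V) (T X Y X' Y' : V -> V) z :
  open U -> U z -> smooth_on U T ->
  differentiable X z -> differentiable Y z ->
  differentiable X' (T z) -> differentiable Y' (T z) ->
  {in U, forall y, X' (T y) = 'D_(X y) T y} ->
  {in U, forall y, Y' (T y) = 'D_(Y y) T y} ->
  flat_bracket X' Y' (T z) = 'D_(flat_bracket X Y z) T z.
Proof.
move=> oU Uz sT dX dY dX' dY' EX EY; have zU : z \in U by rewrite inE.
have dT : differentiable T z by case: (sT 1%N) => + _; exact.
have H (F G F' G' : V -> V) : differentiable G z -> differentiable G' (T z) ->
    {in U, forall y, F' (T y) = 'D_(F y) T y} ->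
    {in U, forall y, G' (T y) = 'D_(G y) T y} ->
    'D_(F' (T z)) G' (T z) = 'D_('D_(F z) G z) T z + 'D_(F z) ('D_(G z) T) z.
  move=> dG dG' EF EG; rewrite EF// -derive_comp//.
  rewrite -(derive_derive _ oU Uz (sT 3%N) dG); apply: near_eq_derive; near=> y.
  by apply: EG; rewrite inE; near: y; exact: open_nbhs_nbhs.
rewrite /flat_bracket !(deriveE _ dT) linearB/= -!(deriveE _ dT).
have hs : forall P Q A B S S' : V, P = A + S -> Q = B + S' -> S = S' -> P - Q = A - B.
  by move=> P Q A B S _ -> -> <-; rewrite opprD addrACA subrr addr0.
exact: (hs _ _ _ _ _ _ (H X Y X' Y' dY dY' EX EY) (H Y X Y' X' dX dX' EY EX)
  (schwarz_row (X z) (Y z) oU Uz (sT 3%N))).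
Unshelve. all: by end_near. Qed.
End Flat.

(* A homeomorphism [coord] from the open set [cdom] onto an open subset of R^n,
   with inverse [param]. Both are total functions, and only their values on
   [cdom] and on [coord @` cdom] are meaningful. *)
Record chart (R : realType) (n : nat) (M : topologicalType) := Chart {
  cdom : set M;
  coord :> M -> 'rV[R]_n;
  param : 'rV[R]_n -> M;
  cdom_open : open cdom;
  cimg_open : open (coord @` cdom);
  coord_continuous : {in cdom, continuous coord};
  param_continuous : {in coord @` cdom, continuous param};
  coordK : {in cdom, cancel coord param} }.

(* [chart_at x] is a choice of a chart of the atlas around x. It serves only to
   represent tangent vectors: T_xM is identified with R^n through the
   coordinates [chart_at x], so a vector field is a function M -> R^n. *)
Record manifold (R : realType) (n : nat) := Manifold {
  carrier :> topologicalType;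
  atlas : set (chart R n carrier);
  chart_at : carrier -> chart R n carrier;
  atlas_compat : forall c e, atlas c -> atlas e ->
    smooth_on (c @` (cdom c `&` cdom e)) (e \o param c);
  chart_at_atlas : forall x, atlas (chart_at x);
  chart_at_dom : forall x, cdom (chart_at x) x;
  carrier_hausdorff : hausdorff_space carrier;
  carrier_second_countable : @second_countable carrier }.
Arguments chart_at {R n m} x : rename.

Section Fields.
Variables (R : realType) (n : nat) (M : manifold R n).
Local Notation V := 'rV[R]_n.
Implicit Types (c e : chart R n M) (x : M).

(* [push c x : T_xM -> R^n] gives the components of a tangent vector in the chart
   c around x, and [pull c x : R^n -> T_xM] is the inverse. *)
Definition push c x : V -> V := 'd (c \o param (chart_at x)) (chart_at x x).
Definition pull c x : V -> V := 'd (chart_at x \o param c) (c x).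

(* components of X in the chart c, as functions of the coordinates y *)
Definition vf_rep (X : M -> V) c (y : V) : V := push c (param c y) (X (param c y)).

Definition smooth_field : {pred M -> V} :=
  mem [set X | forall c, atlas c -> smooth_on (c @` cdom c) (vf_rep X c)].

Lemma smooth_field_submod : submod_closed smooth_field.
Proof.
split=> [|a X Y]; rewrite /smooth_field !inE/=.
  move=> c _ k; rewrite (_ : vf_rep 0 c = cst 0); first exact: Ck_cst.
  by apply/funext => y; rewrite /vf_rep /push linear0.
move=> sX sY c ac k.
rewrite (_ : vf_rep _ c = a *: vf_rep X c + vf_rep Y c).
  apply: CkD; [exact: cimg_open| |exact: sY].
  by apply: CkZ; [exact: cimg_open|exact: sX].
by apply/funext => y; rewrite /vf_rep /push !fctE linearP.
Qed.
HB.instance Definition _ := GRing.isSubmodClosed.Build R (M -> V) smooth_field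
  (smooth_field_submod).

(* the real vector space of smooth vector fields on M *)
Record vfield := VField { vf :> M -> V; _ : vf \in smooth_field }.
HB.instance Definition _ := [isSub for vf].
HB.instance Definition _ := [Choice of vfield by <:].
HB.instance Definition _ := [SubChoice_isSubLmodule of vfield by <:].

(* The bracket at x is computed in the chart [chart_at x]; by [vf_rep_lie_bracket] any
   other chart around x gives the same vector. *)
Definition lie_bracket_fun (X Y : M -> V) x : V :=
  flat_bracket (vf_rep X (chart_at x)) (vf_rep Y (chart_at x)) (chart_at x x).

Lemma coordV c x : cdom c x -> param c (c x) = x.
Proof. by move=> cx; rewrite coordK// inE. Qed.

Lemma overlap_open c e : open (c @` (cdom c `&` cdom e)).
Proof.
rewrite openE => _ [x [cx ex] <-]; rewrite /interior.
have Ic : (c @` cdom c) (c x) by exists x.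
have pc : {for c x, continuous (param c)} by apply: param_continuous; rewrite inE.
have : \forall y \near c x, cdom e (param c y).
  by apply: pc; rewrite coordV//; apply: open_nbhs_nbhs; split=> //; exact: cdom_open.
move=> He; near=> y.
have [z cz zy] : (c @` cdom c) y.
  by near: y; apply: open_nbhs_nbhs; split=> //; exact: cimg_open.
exists z => //; split=> //.
by rewrite -(coordV cz) zy; near: y.
Unshelve. all: by end_near. Qed.

Lemma transition_differentiable c e x : atlas c -> atlas e ->
  cdom c x -> cdom e x -> differentiable (e \o param c) (c x).
Proof.
move=> ac ae cx ex; case: (atlas_compat ac ae 1) => + _; apply.
by rewrite inE; exists x.
Qed.

Lemma transition_cocycle c e g x v : atlas c -> atlas e -> atlas g ->
  cdom c x -> cdom e x -> cdom g x ->
  'd (g \o param e) (e x) ('d (e \o param c) (c x) v) = 'd (g \o param c) (c x) v.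
Proof.
move=> ac ae ag cx ex gx.
have dec := transition_differentiable ac ae cx ex.
have dge := transition_differentiable ae ag ex gx.
have dgc := transition_differentiable ac ag cx gx.
have E : (e \o param c) (c x) = e x by rewrite /= coordV.
have dge' : differentiable (g \o param e) ((e \o param c) (c x)) by rewrite E.
apply: (etrans (y := 'D_v ((g \o param e) \o (e \o param c)) (c x))).
  apply/esym; apply: (etrans (derive_comp v dec dge')).
  by apply: (etrans (deriveE _ dge')); rewrite (deriveE v dec) E.
apply: etrans (deriveE v dgc); apply: near_eq_derive; near=> y.
have [z [cz ez] <-] : (c @` (cdom c `&` cdom e)) y.
  by near: y; apply: open_nbhs_nbhs; split; [exact: overlap_open|exists x].
by rewrite /= coordV// coordV.
Unshelve. all: by end_near. Qed.

Lemma vf_rep_transition (X : M -> V) c e x : atlas c -> atlas e ->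
  cdom c x -> cdom e x ->
  vf_rep X e (e x) = 'D_(vf_rep X c (c x)) (e \o param c) (c x).
Proof.
move=> ac ae cx ex.
apply: etrans (esym (deriveE _ (transition_differentiable ac ae cx ex))).
rewrite /vf_rep (coordV ex) (coordV cx); apply: esym.
exact: (transition_cocycle (X x) (chart_at_atlas x) ac ae (chart_at_dom x) cx ex).
Qed.

Lemma smooth_field_rep (X : vfield) c : atlas c ->
  smooth_on (c @` cdom c) (vf_rep X c).
Proof. by case: X => X /=; rewrite /smooth_field inE/= => + ac; apply. Qed.

Lemma vf_rep_differentiable (X : vfield) c x : atlas c -> cdom c x ->
  differentiable (vf_rep X c) (c x).
Proof.
move=> ac cx; case: (smooth_field_rep X ac 1) => + _; apply.
by rewrite inE; exists x.
Qed.

Lemma vf_rep_lie_bracket (X Y : vfield) c x : atlas c -> cdom c x ->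
  vf_rep (lie_bracket_fun X Y) c (c x) = flat_bracket (vf_rep X c) (vf_rep Y c) (c x).
Proof.
move=> ac cx.
have ac0 := chart_at_atlas x; have c0x := chart_at_dom x.
have E : (c \o param (chart_at x)) (chart_at x x) = c x by rewrite /= coordV.
rewrite -[in RHS]E.
rewrite (flat_bracket_pushforward (U := chart_at x @` (cdom (chart_at x) `&` cdom c))
   (X := vf_rep X (chart_at x)) (Y := vf_rep Y (chart_at x))).
- apply: etrans (esym (deriveE _ (transition_differentiable ac0 ac c0x cx))).
  by rewrite /vf_rep (coordV cx).
- exact: overlap_open.
- by exists x.
- exact: atlas_compat.
- exact: vf_rep_differentiable.
- exact: vf_rep_differentiable.
- by rewrite E; exact: vf_rep_differentiable.
- by rewrite E; exact: vf_rep_differentiable.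
- move=> y; rewrite inE => -[z [c0z cz] <-] /=.
  by rewrite coordV//; exact: vf_rep_transition.
- move=> y; rewrite inE => -[z [c0z cz] <-] /=.
  by rewrite coordV//; exact: vf_rep_transition.
Qed.

Lemma smooth_lie_bracket (X Y : vfield) : lie_bracket_fun X Y \in smooth_field.
Proof.
rewrite /smooth_field inE/= => c ac k.
apply: (Ck_eq (f := flat_bracket (vf_rep X c) (vf_rep Y c))).
- exact: cimg_open.
- by move=> _ [x cx <-]; rewrite vf_rep_lie_bracket.
- apply: smooth_flat_bracket; [exact: cimg_open|exact: smooth_field_rep..].
Qed.

Definition lie_bracket (X Y : vfield) : vfield := VField (smooth_lie_bracket X Y).

(* The ambient space of all forms; [smooth_form r] carves out Omega^r(M): an
   r-form is at each x an alternating r-linear form on T_xM in the sense of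
   [alternating_form], hence vanishes on the lists of length other than r. The
   degrees that the operations below would make negative thus contain only 0. *)
Definition diff_form := M -> seq V -> R.
HB.instance Definition _ := GRing.Lmodule.on diff_form.

(* The function a_c(y)(v) on the coordinate domain of c, for v a list of vectors
   of R^n: with v made of vectors of the standard basis these are the components
   of a in the chart c. *)
Definition form_rep (a : diff_form) c (y : V) (v : seq V) : R :=
  a (param c y) (map (pull c (param c y)) v).

Definition smooth_form r (a : diff_form) : Prop :=
  (forall x, alternating_form r (a x)) /\
  forall c v, atlas c -> smooth_on (c @` cdom c) (fun y => form_rep a c y v).

(* v without its entry of index i (counted from 0) *)
Definition del (T : Type) i (v : seq T) := take i v ++ drop i.+1 v.

(* In coordinates d (sum_I a_I dy^I) = sum_I da_I /\ dy^I, that is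
   (da)(v_0, ..., v_r) = sum_i (-1)^i D_(v_i) (a_c)(v_0, .., ^v_i, .., v_r)
   with v_0, ..., v_r constant in the chart c = chart_at x.  *)
Definition exterior_derivative (a : diff_form) : diff_form := fun x v =>
  \sum_(i < size v) (-1) ^+ i *
    'D_(v`_i) (fun y => form_rep a (chart_at x) y (del i v)) (chart_at x x).

(* In coordinates (L_X a)(v_1, ..., v_r) =
   (D_X a_c)(v_1, ..., v_r) + sum_i a(v_1, ..., D_(v_i) X, ..., v_r), the
   derivative at t = 0 of the pullback of a by the flow of X. *)
Definition lie_derivative (X : vfield) (a : diff_form) : diff_form := fun x v =>
  'D_(X x) (fun y => form_rep a (chart_at x) y v) (chart_at x x) +
  \sum_(i < size v)
    a x (set_nth 0 v i ('D_(v`_i) (vf_rep X (chart_at x)) (chart_at x x))).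

(* p is a smooth section of the bundle with fibres Lambda^s T_xM: in each chart,
   the components of p, i.e. its pairings with the constant s-forms w on R^n, are
   smooth. *)
Definition multivector_field s (p : M -> extpow V s) : Prop :=
  forall c (w : seq V -> R), atlas c -> alternating_form s w ->
  smooth_on (c @` cdom c)
    (fun y => ext_lift (fun v => w (map (push c (param c y)) v)) (p (param c y))).

(* (X_1 /\ .. /\ X_s) _| a = a(X_1, .., X_s, -); for s > r the value is 0 since the
   list u ++ v is then too long. *)
Definition interior_product s (p : M -> extpow V s) (a : diff_form) : diff_form := fun x v =>
  ext_lift (fun u => a x (u ++ v)) (p x).

(* X_1 /\ .. /\ X_s over the reals |-> (x |-> X_1(x) /\ .. /\ X_s(x)) *)
Definition multivector_of s (P : extpow vfield s) : M -> extpow V s := fun x =>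
  ext_lift (fun Q : seq vfield => wedge s [seq X x | X : vfield <- Q]) P.

(* Indices are counted from 0 here, so the signs (-1)^(i-1) and (-1)^(i+j) of
   indices counted from 1 read (-1)^i and (-1)^(i+j). The two functions of Q
   below are R-multilinear and alternating (for a smooth form a). *)
Definition contract_lie_derivative s (P : extpow vfield s) (a : diff_form) : diff_form :=
  ext_lift (fun Q : seq vfield =>
    \sum_(i < size Q)
       interior_product (multivector_of ((-1) ^+ i *: wedge s.-1 (del i Q))) (lie_derivative Q`_i a)) P.

Definition bracket_op s (P : extpow vfield s) : extpow vfield s.-1 :=
  ext_lift (fun Q : seq vfield =>
    \sum_(j < size Q) \sum_(i < j)
      (-1) ^+ (i + j) *: wedge s.-1 (lie_bracket Q`_i Q`_j :: del i (del j Q))) P.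
End Fields.

(* Main.v *)
(* Evaluate both sides at a point, in the chart used there, and by linearity on
   P = X_1 /\ .. /\ X_s. Put S(G)(v) = sum_i (-1)^i G(v_i, v without v_i). The
   exterior derivative, the zeroth-order term of the Lie derivative (after moving
   the modified argument to the front) and the Leibniz rule for
   y |-> a_y(X_1(y), .., X_s(y), v) are all of this form. S over a concatenated
   list splits in two; the derivatives of the components of a then match termwise,
   the terms differentiating X_i along v_j match by exchanging two such sums, and
   the terms differentiating X_i along X_j form an iterated S, which
   antisymmetrizes into the brackets [X_i, X_j]. *)
Require Import Defs.
From mathcomp Require Import all_boot all_order all_algebra.
From mathcomp Require Import all_classical all_reals topology normedtype.
From mathcomp Require Import derive.
Set Implicit Arguments.
Unset Strict Implicit.
Unset Printing Implicit Defensive.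
Import Order.TTheory GRing.Theory Num.Theory numFieldNormedType.Exports.
Local Open Scope ring_scope.

(** * Alternating sums over the entries of a list, and alternating multilinear functions *)

Section AlternatingSum.
Variable K : comNzRingType.

Definition alt_sum (T : zmodType) (G : T -> seq T -> K) (v : seq T) : K :=
  \sum_(i < size v) (-1) ^+ i * G v`_i (del i v).

Lemma alt_sum_nil (T : zmodType) (G : T -> seq T -> K) : alt_sum G [::] = 0.
Proof. by rewrite /alt_sum big_ord0. Qed.

Lemma alt_sum_cons (T : zmodType) (G : T -> seq T -> K) x v :
  alt_sum G (x :: v) = G x v - alt_sum (fun a l => G a (x :: l)) v.
Proof.
rewrite /alt_sum /= big_ord_recl /= mul1r /del /= drop0 -sumrN; congr (_ + _).
by apply: eq_bigr => i _; rewrite exprS mulN1r mulNr.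
Qed.

Lemma eq_alt_sum (T : zmodType) (G H : T -> seq T -> K) v :
  (forall a l, G a l = H a l) -> alt_sum G v = alt_sum H v.
Proof. by move=> GH; apply: eq_bigr => i _; rewrite GH. Qed.

Lemma alt_sum_lin (T : zmodType) (I : Type) (r : seq I) (P : pred I)
    (k : I -> K) (G : I -> T -> seq T -> K) v :
  alt_sum (fun a l => \sum_(i <- r | P i) k i * G i a l) v
  = \sum_(i <- r | P i) k i * alt_sum (G i) v.
Proof.
under [RHS]eq_bigr => i _ do rewrite mulr_sumr.
rewrite exchange_big; apply: eq_bigr => i _.
by rewrite mulr_sumr; apply: eq_bigr => j _; rewrite mulrCA.
Qed.

Lemma alt_sumD (T : zmodType) (G H : T -> seq T -> K) v :
  alt_sum (fun a l => G a l + H a l) v = alt_sum G v + alt_sum H v.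
Proof. by rewrite -big_split; apply: eq_bigr => i _; rewrite mulrDr. Qed.

Lemma alt_sumZ (T : zmodType) k (G : T -> seq T -> K) v :
  alt_sum (fun a l => k * G a l) v = k * alt_sum G v.
Proof. by rewrite mulr_sumr; apply: eq_bigr => i _; rewrite mulrCA. Qed.

Lemma alt_sumN (T : zmodType) (G : T -> seq T -> K) v :
  alt_sum (fun a l => - G a l) v = - alt_sum G v.
Proof. by rewrite -sumrN; apply: eq_bigr => i _; rewrite mulrN. Qed.

Lemma alt_sum_cat (T : zmodType) (G : T -> seq T -> K) u w :
  alt_sum G (u ++ w) = alt_sum (fun a l => G a (l ++ w)) u
    + (-1) ^+ size u * alt_sum (fun a l => G a (u ++ l)) w.
Proof.
elim: u G => [|x u IH] G; first by rewrite alt_sum_nil add0r mul1r.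
rewrite cat_cons !alt_sum_cons IH opprD addrA; congr (_ + _).
by rewrite exprS mulN1r mulNr.
Qed.

Lemma alt_sum_map (T U : zmodType) (h : U -> T) (G : T -> seq T -> K) u :
  alt_sum G (map h u) = alt_sum (fun a l => G (h a) (map h l)) u.
Proof.
elim: u G => [|x u IH] G; first by rewrite !alt_sum_nil.
by rewrite /= !alt_sum_cons IH.
Qed.

Lemma alt_sum_exchange (T U : zmodType) (G : T -> seq T -> U -> seq U -> K) u w :
  alt_sum (fun a l => alt_sum (G a l) w) u
  = alt_sum (fun b m => alt_sum (fun a l => G a l b m) u) w.
Proof.
rewrite /alt_sum; under eq_bigr => i _ do rewrite mulr_sumr.
rewrite exchange_big; apply: eq_bigr => i _.
by rewrite mulr_sumr; apply: eq_bigr => j _; rewrite mulrCA.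
Qed.

(** Each pair [i < j] is removed in two orders. Removing entry [i] first shifts entry [j] down by
    one position, so the two orders carry opposite signs. *)
Lemma alt_sum_alt_sum (T : zmodType) (H : T -> T -> seq T -> K) u :
  alt_sum (fun x l => alt_sum (H x) l) u
  = \sum_(j < size u) \sum_(i < j) (-1) ^+ (i + j) *
      (H u`_j u`_i (del i (del j u)) - H u`_i u`_j (del i (del j u))).
Proof.
elim: u H => [|x u IH] H; first by rewrite alt_sum_nil big_ord0.
rewrite alt_sum_cons big_ord_recl big_ord0 add0r.
under [X in _ - X]eq_alt_sum => a l do rewrite alt_sum_cons.
rewrite alt_sumD alt_sumN opprD opprK IH addrA.
rewrite -sumrN -!big_split; apply: eq_bigr => j _ /=.
rewrite big_ord_recl /= /del /= !drop0 add0n; congr (_ + _).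
  by rewrite exprS mulN1r mulNr mulrBr opprB.
apply: eq_bigr => i _.
by rewrite /bump /= !add1n addSn addnS !exprS !mulN1r opprK.
Qed.

Variable V : lmodType K.

(* The conditions of [alternating_form] without the one on the degree. *)
Definition alternating (f : seq V -> K) : Prop :=
  (forall (u w : seq V) a x y,
     f (u ++ (a *: x + y) :: w) = a * f (u ++ x :: w) + f (u ++ y :: w)) /\
  (forall (u v w : seq V) x, f (u ++ x :: v ++ x :: w) = 0).

Lemma alternating_catl f u : alternating f -> alternating (fun l => f (u ++ l)).
Proof.
move=> [fL fA]; split=> [u' w a x y|u' v w x]; first by rewrite !catA fL.
by rewrite catA fA.
Qed.

Lemma alternating_catr f w : alternating f -> alternating (fun l => f (l ++ w)).
Proof.
move=> [fL fA]; split=> [u w' a x y|u v w' x]; first by rewrite -!catA !cat_cons fL.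
by rewrite -!catA !cat_cons -catA cat_cons fA.
Qed.

Lemma alternatingD f g : alternating f -> alternating g ->
  alternating (fun l => f l + g l).
Proof.
move=> [fL fA] [gL gA]; split=> [u w a x y|u v w x]; last by rewrite fA gA addr0.
by rewrite fL gL mulrDr addrACA.
Qed.

Lemma alternating_swap f x y w : alternating f ->
  f (x :: y :: w) = - f (y :: x :: w).
Proof.
move=> [fL fA]; apply/eqP; rewrite -addr_eq0; apply/eqP.
(* Polarization of [f] on a repeated sum; the coefficient [1] gives the sum the shape in which
   linearity is stated. *)
have := fA [::] [::] w (1 *: x + y).
rewrite /= (fL [::]) (fL [:: x]) (fL [:: y]) !mul1r /=.
by rewrite (fA [::] [::]) (fA [::] [::]) add0r addr0.
Qed.

Lemma alternating_head_lin f (k : K) x y w : alternating f ->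
  f (k *: x + y :: w) = k * f (x :: w) + f (y :: w).
Proof. by move=> [fL _]; exact: (fL [::]). Qed.

Lemma alternating_headB f x y w : alternating f ->
  f (x - y :: w) = f (x :: w) - f (y :: w).
Proof.
by move=> fA; rewrite addrC -scaleN1r alternating_head_lin// mulN1r addrC.
Qed.

Lemma alternating_head_sum f n (k : 'I_n -> K) (e : 'I_n -> V) w : alternating f ->
  f (\sum_i k i *: e i :: w) = \sum_i k i * f (e i :: w).
Proof.
move=> fA; have f0 : f (0 :: w) = 0.
  apply: (addrI (f (0 :: w))); rewrite addr0 -{1}[f _]mul1r.
  by rewrite -alternating_head_lin// scaler0 addr0.
elim/big_rec2 : _ => // i _ x _ <-; exact: alternating_head_lin.
Qed.

(** Bringing the modified entry from position [i] to the front takes [i] transpositions, which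
    produce the sign [(-1) ^+ i]. *)
Lemma alt_sum_set_nth f (A : V -> V) v : alternating f ->
  \sum_(i < size v) f (set_nth 0 v i (A v`_i)) = alt_sum (fun a l => f (A a :: l)) v.
Proof.
elim: v f => [|x v IH] f fA; first by rewrite alt_sum_nil big_ord0.
rewrite alt_sum_cons big_ord_recl /=; congr (_ + _).
rewrite (IH (fun l => f (x :: l))); last exact: (alternating_catl [:: x]).
by rewrite -alt_sumN; apply: eq_alt_sum => a l; exact: alternating_swap.
Qed.

Lemma alternating_alt_sum (G : V -> seq V -> K) :
  (forall k a b l, G (k *: a + b) l = k * G a l + G b l) ->
  (forall a, alternating (G a)) -> alternating (alt_sum G).
Proof.
move=> GL GA; split.
  move=> u w k x y; elim: u G GL GA => [|c u IH] G GL GA /=.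
    rewrite !alt_sum_cons GL mulrBr addrACA -opprD -alt_sumZ -alt_sumD.
    congr (_ - _); apply: eq_alt_sum => a l; exact: alternating_head_lin.
  rewrite !alt_sum_cons (GA c).1 IH//.
    by rewrite mulrBr addrACA opprD.
  by move=> a; exact: (alternating_catl [:: c]).
(* Removing any entry other than the displayed [x] leaves [x] twice; removing that one puts [x] in
   front, and moving the other copy back to its place absorbs the sign. *)
have pull_out x v w H : (forall a, alternating (H a)) ->
    alt_sum (fun a l => H a (x :: l)) (v ++ x :: w) = H x (v ++ x :: w).
  elim: v H => [|c v IH] H HA; rewrite /= alt_sum_cons.
    by rewrite [X in _ - X]big1 ?subr0// => i _; rewrite ((HA _).2 [::] [::]) mulr0.
  rewrite ((HA _).2 [::]) add0r -alt_sumN -(IH (fun a l => H a (c :: l))).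
    by apply: eq_alt_sum => a l; rewrite (alternating_swap _ _ _ (HA a)) opprK.
  by move=> a; exact: (alternating_catl [:: c]).
(* Entries before the first [x] are peeled off, since removing one leaves both copies; once [x] is
   at the head, [pull_out] shows that its two removals cancel. *)
move=> u v w x; elim: u G GL GA => [|c u IH] G GL GA; rewrite /= alt_sum_cons.
  by rewrite pull_out// subrr.
rewrite (GA c).2 IH ?subr0// => a; exact: (alternating_catl [:: c]).
Qed.

End AlternatingSum.

(** * Linear extension to the exterior power *)

Section ExteriorPowerLift.
Variables (K : fieldType) (V : lmodType K) (s : nat).

(** Every [ext_lift] sums over this same filtered [repr P], so the terms of the formula can later be
    compared tuple by tuple. *)
Lemma ext_sum_wedge (P : extpow V s) :
  P = \sum_(t <- repr P | size t.2 == s) t.1 *: wedge s t.2.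
Proof. by rewrite -[LHS]ext_lift_wedge_id. Qed.

(* [ext_lift] only evaluates [f] on lists of length [s], so the degree condition
   of [alternating_form] can be dropped. *)
Definition degree_restrict (f : seq V -> K^o) (u : seq V) : K^o :=
  if size u == s then f u else 0.

Lemma ext_lift_restrict (f : seq V -> K^o) :
  ext_lift (s := s) f = ext_lift (degree_restrict f).
Proof.
by apply/funext => P; apply: eq_bigr => t st; rewrite /degree_restrict st.
Qed.

Lemma degree_restrict_alternating (f : seq V -> K^o) :
  alternating f -> alternating_form s (degree_restrict f).
Proof.
move=> [fL fA]; split=> [u w a x y|u v w x|u us]; rewrite /degree_restrict.
- rewrite !size_cat /=; case: ifP => _; first exact: fL.
  by rewrite scaler0 addr0.
- by case: ifP => // _; exact: fA.
- by rewrite (negbTE us).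
Qed.

Lemma ext_lift_alternating_wedge (f : seq V -> K^o) u :
  alternating f -> size u = s -> ext_lift f (wedge s u) = f u.
Proof.
move=> fA us; rewrite ext_lift_restrict ext_lift_wedge.
  by rewrite /degree_restrict us eqxx.
exact: degree_restrict_alternating.
Qed.

Lemma ext_lift_sum (W : lmodType K) (f : seq V -> W) I (r : seq I) (p : pred I)
    (k : I -> K) (Q : I -> extpow V s) : alternating_form s f ->
  ext_lift f (\sum_(i <- r | p i) k i *: Q i)
  = \sum_(i <- r | p i) k i *: ext_lift f (Q i).
Proof.
move=> fA; have f0 : ext_lift f (0 : extpow V s) = 0.
  by apply: etrans (ext_lift_pi [::] fA) _; rewrite /feval big_nil.
elim/big_rec2 : _ => // i _ x _ <-; exact: ext_lift_linear.
Qed.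

Lemma ext_lift_alternating_sum (f : seq V -> K^o) I (r : seq I) (p : pred I)
    (k : I -> K) (Q : I -> extpow V s) : alternating f ->
  ext_lift f (\sum_(i <- r | p i) k i *: Q i)
  = \sum_(i <- r | p i) k i *: ext_lift f (Q i).
Proof.
move=> fA; rewrite ext_lift_restrict ext_lift_sum//.
exact: degree_restrict_alternating.
Qed.

Lemma alternating_form_map (U W : lmodType K) (h : U -> V) (f : seq V -> W) :
  linear h -> alternating_form s f -> alternating_form s (f \o map h).
Proof.
move=> hL [fL fA f0]; split=> [u w a x y|u v w x|u us] /=.
- by rewrite !map_cat /= hL fL.
- by rewrite !(map_cat, map_cons) fA.
- by rewrite f0// size_map.
Qed.

End ExteriorPowerLift.

(** * Leibniz rule for a form evaluated on fields in coordinates *)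

Section Leibniz.
Variables (R : realType) (n : nat).
Local Notation V := 'rV[R]_n.

Lemma derive_alternating (beta : V -> seq V -> R) z a :
  (forall y, alternating (beta y)) ->
  (forall l, differentiable (beta^~ l) z) ->
  alternating (fun l => 'D_a (beta^~ l) z).
Proof.
move=> bA bd; have bv l : derivable (beta^~ l) z a := diff_derivable (bd l).
split=> [u w k x y|u v w x].
  rewrite (_ : beta^~ _ = k *: (beta^~ (u ++ x :: w)) + (beta^~ (u ++ y :: w))).
    by rewrite deriveD ?deriveZ//; exact: derivableZ.
  by apply/funext => y'; rewrite (bA y').1.
rewrite (_ : beta^~ _ = cst 0) ?derive_cst//.
by apply/funext => y; rewrite (bA y).2.
Qed.

(** Induction on [Q]: the first argument is expanded in the standard basis and the product rule is
    applied to its components. Differentiability is proved alongside because the product rule needs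
    it for the remaining factor. *)
Lemma derive_leibniz (T : zmodType) (F : T -> V -> V) (beta : V -> seq V -> R)
    (Q : seq T) (w : seq V) z :
  (forall y, alternating (beta y)) ->
  (forall l, differentiable (beta^~ l) z) ->
  (forall X, differentiable (F X) z) ->
  differentiable (fun y => beta y ([seq F X y | X <- Q] ++ w)) z /\
  forall a, 'D_a (fun y => beta y ([seq F X y | X <- Q] ++ w)) z =
    'D_a (beta^~ ([seq F X z | X <- Q] ++ w)) z +
    alt_sum (fun X m => beta z ('D_a (F X) z :: [seq F X z | X <- m] ++ w)) Q.
Proof.
move=> + + Fd; elim: Q beta => [|X Q IH] beta bA bd /=.
  by split=> // a; rewrite alt_sum_nil addr0.
pose e (k : 'I_n) : V := delta_mx 0 k.
have headE y (x : V) l : beta y (x :: l) = \sum_k x 0 k * beta y (e k :: l).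
  by rewrite {1}[x]row_sum_delta alternating_head_sum.
have [dk Dk] : (forall k, differentiable
     (fun y => beta y (e k :: [seq F X y | X <- Q] ++ w)) z) /\
   (forall k a, 'D_a (fun y => beta y (e k :: [seq F X y | X <- Q] ++ w)) z =
    'D_a (beta^~ (e k :: [seq F X z | X <- Q] ++ w)) z +
    alt_sum (fun X m => beta z (e k :: 'D_a (F X) z :: [seq F X z | X <- m] ++ w)) Q).
  split=> k; have [] := IH (fun y l => beta y (e k :: l)) _ _ => //;
    by move=> y; exact: (alternating_catl [:: e k]).
have dF k : differentiable (fun y => F X y 0 k) z.
  apply: (@differentiable_comp _ _ _ _ (F X) (fun w : 'rV_n => w 0 k)) => //.
  exact: differentiable_coord.
have E : (fun y => beta y (F X y :: [seq F X y | X <- Q] ++ w)) =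
  \sum_k ((fun y => F X y 0 k) * (fun y => beta y (e k :: [seq F X y | X <- Q] ++ w))).
  by apply/funext => y; rewrite headE fct_sumE.
split.
  by rewrite E; apply: differentiable_sum => k; exact: differentiableM.
move=> a; rewrite E derive_sum; last first.
  by move=> k; apply: derivableM; exact: diff_derivable.
under eq_bigr => k _.
  rewrite (deriveM (diff_derivable (dF k)) (diff_derivable (dk k))) Dk.
  rewrite -(derive_row k (diff_derivable (v := a) (Fd X))).
  rewrite /GRing.scale /= mulrDr [X in _ + X]mulrC.
  over.
rewrite !big_split /= -headE.
have DA := derive_alternating a bA bd.
have headD x l : 'D_a (beta^~ (x :: l)) z = \sum_k x 0 k * 'D_a (beta^~ (e k :: l)) z.
  by rewrite {1}[x]row_sum_delta; exact: (alternating_head_sum (fun k => x 0 k) e l DA).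
rewrite headD alt_sum_cons -!addrA; congr (_ + _); rewrite addrC; congr (_ + _).
(* The components recombine into [F X z]; exchanging it with the differentiated argument gives the
   minus sign of [alt_sum_cons]. *)
rewrite -alt_sum_lin -alt_sumN; apply: eq_alt_sum => Y m.
by rewrite -headE alternating_swap.
Qed.
End Leibniz.

Lemma size_del (T : Type) i (v : seq T) : (i < size v)%N -> size (del i v) = (size v).-1.
Proof.
move=> iv; rewrite /del size_cat size_take iv size_drop.
by rewrite -[in RHS](subnKC iv).
Qed.

(** * The formula for decomposable multivectors in a coordinate chart *)

Section FlatCartan.
Variables (R : realType) (n : nat).
Local Notation V := 'rV[R]_n.

Lemma flat_cartan (T : zmodType) (F : T -> V -> V) (beta : V -> seq V -> R)
    (Q : seq T) (w : seq V) z :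
  (forall y, alternating (beta y)) ->
  (forall l, differentiable (beta^~ l) z) ->
  (forall X, differentiable (F X) z) ->
  alt_sum (fun a l => 'D_a (beta^~ l) z) ([seq F X z | X <- Q] ++ w)
  - (-1) ^+ size Q *
    alt_sum (fun a l => 'D_a (fun y => beta y ([seq F X y | X <- Q] ++ l)) z) w
  = alt_sum (fun X l =>
      'D_(F X z) (beta^~ ([seq F X z | X <- l] ++ w)) z
      + alt_sum (fun a m => beta z ('D_a (F X) z :: m)) ([seq F X z | X <- l] ++ w)) Q
    - \sum_(j < size Q) \sum_(i < j) (-1) ^+ (i + j) *
        beta z (flat_bracket (F Q`_i) (F Q`_j) z
                :: [seq F X z | X <- del i (del j Q)] ++ w).
Proof.
move=> bA bd Fd.
rewrite alt_sum_cat size_map.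
under [X in _ - _ * X]eq_alt_sum => a l.
  rewrite (derive_leibniz Q l bA bd Fd).2.
  over.
(* The derivatives of [beta] along the entries of [w] cancel, and those along the fields match the
   first part of the right side. *)
rewrite !alt_sumD mulrDr opprD addrA addrK alt_sum_map -addrA; congr (_ + _).
rewrite alt_sum_exchange.
have -> : alt_sum (fun X l => alt_sum (fun a m => beta z ('D_a (F X) z :: m))
      ([seq F X z | X <- l] ++ w)) Q =
   alt_sum (fun X l => alt_sum (fun Y m =>
        beta z ('D_(F Y z) (F X) z :: [seq F X z | X <- m] ++ w)) l
     + (-1) ^+ (size Q).-1 * alt_sum (fun a m =>
         beta z ('D_a (F X) z :: [seq F X z | X <- l] ++ m)) w) Q.
  apply: eq_bigr => i _; rewrite alt_sum_cat alt_sum_map size_map.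
  by rewrite size_del.
rewrite alt_sumD alt_sumZ alt_sum_alt_sum.
have -> : (-1 : R) ^+ (size Q).-1 * alt_sum (fun X l =>
     alt_sum (fun a m => beta z ('D_a (F X) z :: [seq F X z | X <- l] ++ m)) w) Q
  = - ((-1) ^+ size Q * alt_sum (fun X l =>
     alt_sum (fun a m => beta z ('D_a (F X) z :: [seq F X z | X <- l] ++ m)) w) Q).
  (* For empty [Q], where [(size Q).-1] is truncated to [0], both sums vanish. *)
  case: (Q) => [|X Q']; first by rewrite alt_sum_nil !mulr0 oppr0.
  by rewrite /= exprS mulN1r mulNr opprK.
(* Once the sums over [w] are matched, each pair [i < j] leaves two derivatives whose difference is
   [flat_bracket]. *)
rewrite addrAC; apply/esym; rewrite -[RHS]add0r; congr (_ + _).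
apply/eqP; rewrite subr_eq0; apply/eqP.
apply: eq_bigr => j _; apply: eq_bigr => i _; congr (_ * _).
exact/esym/alternating_headB.
Qed.
End FlatCartan.

(** * Coordinate representations on the manifold and contraction with wedge products *)

Section Manifold.
Variables (R : realType) (n : nat) (M : manifold R n).
Local Notation V := 'rV[R]_n.

(** Tangent vectors at [x] are recorded in the coordinates of [chart_at x], and the transition from
    this chart to itself is the identity near the point. *)
Lemma push_chart_at (x : M) (v : V) : push (chart_at x) x v = v.
Proof.
have a0 := chart_at_atlas x; have d0 := chart_at_dom x.
rewrite /push -deriveE; last exact: transition_differentiable.
rewrite (near_eq_derive (g := id)); first by rewrite derive_id.
near=> y.
have [z cz <-] : (chart_at x @` cdom (chart_at x))%classic y.
  near: y; apply: open_nbhs_nbhs; split; first exact: cimg_open.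
  by exists x.
by rewrite /= coordV.
Unshelve. all: by end_near. Qed.

(** For this chart [pull] and [push] unfold to the same differential. *)
Lemma pull_chart_at (x : M) (v : V) : pull (chart_at x) x v = v.
Proof. exact: push_chart_at. Qed.

(** By the cocycle rule, passing from [chart_at x] to [c] and back is the transition of [chart_at x]
    to itself. *)
Lemma pull_push c (x : M) (v : V) : atlas c -> cdom c x -> pull c x (push c x v) = v.
Proof.
move=> ac cx; rewrite -[RHS](push_chart_at x) /pull /push.
have a0 := chart_at_atlas x; have d0 := chart_at_dom x.
exact: (transition_cocycle v a0 ac a0 d0 cx d0).
Qed.

Lemma vf_rep_chart_at (X : M -> V) x : vf_rep X (chart_at x) (chart_at x x) = X x.
Proof. by rewrite /vf_rep coordV ?push_chart_at//; exact: chart_at_dom. Qed.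

Lemma form_rep_chart_at (a : diff_form M) x v :
  form_rep a (chart_at x) (chart_at x x) v = a x v.
Proof.
rewrite /form_rep coordV; last exact: chart_at_dom.
by congr (a x _); rewrite -[RHS]map_id; apply: eq_map => u; exact: pull_chart_at.
Qed.

Section SmoothForm.
Variables (r : nat) (alpha : diff_form M) (sa : smooth_form r alpha).

Lemma smooth_form_alternating x : alternating (alpha x).
Proof. by have [fL fA _] := sa.1 x; split. Qed.

Lemma form_rep_alternating c y : alternating (form_rep alpha c y).
Proof.
have [fL fA] := smooth_form_alternating (param c y).
split=> [u w k v v'|u v w v']; rewrite /form_rep.
  by rewrite !map_cat /= /pull linearP fL.
by rewrite !(map_cat, map_cons) fA.
Qed.

Lemma form_rep_differentiable x l :
  differentiable ((form_rep alpha (chart_at x))^~ l) (chart_at x x).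
Proof.
case: (sa.2 (chart_at x) l (chart_at_atlas x) 1%N) => + _; apply.
by rewrite inE; exists x => //; exact: chart_at_dom.
Qed.

Lemma exterior_derivative_alt_sum x v : exterior_derivative alpha x v =
  alt_sum (fun a l => 'D_a ((form_rep alpha (chart_at x))^~ l) (chart_at x x)) v.
Proof. by []. Qed.

(** Linearity of [ext_lift] is available for alternating functions, so this allows the contraction
    of the derivative to be expanded over wedge products. *)
Lemma exterior_derivative_alternating x : alternating (exterior_derivative alpha x).
Proof.
rewrite (funext (exterior_derivative_alt_sum x)).
apply: alternating_alt_sum => [k a b l|a].
  have df := form_rep_differentiable x l.
  by rewrite !deriveE// linearP.
apply: derive_alternating; first by move=> y; exact: form_rep_alternating.
by move=> l; exact: form_rep_differentiable.
Qed.

Lemma lie_derivative_alt_sum (X : vfield M) x v : lie_derivative X alpha x v =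
  'D_(X x) ((form_rep alpha (chart_at x))^~ v) (chart_at x x) +
  alt_sum (fun a l => alpha x ('D_a (vf_rep X (chart_at x)) (chart_at x x) :: l)) v.
Proof.
congr (_ + _).
exact: (alt_sum_set_nth (fun a => 'D_a (vf_rep X (chart_at x)) (chart_at x x)) _
  (smooth_form_alternating x)).
Qed.

Lemma lie_derivative_alternating (X : vfield M) x : alternating (lie_derivative X alpha x).
Proof.
have dX : differentiable (vf_rep X (chart_at x)) (chart_at x x).
  by apply: vf_rep_differentiable; [exact: chart_at_atlas|exact: chart_at_dom].
rewrite (funext (lie_derivative_alt_sum X x)); apply: alternatingD.
  apply: derive_alternating; first by move=> y; exact: form_rep_alternating.
  by move=> l; exact: form_rep_differentiable.
apply: alternating_alt_sum => [k a b l|a].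
  rewrite !deriveE// linearP.
  exact/alternating_head_lin/smooth_form_alternating.
exact: (alternating_catl [:: _] (smooth_form_alternating x)).
Qed.
End SmoothForm.

Definition eval_fields (x : M) (Q : seq (vfield M)) : seq V := [seq X x | X : vfield M <- Q].

Lemma multivector_of_form s x :
  alternating_form s (fun Q : seq (vfield M) => wedge s (eval_fields x Q)).
Proof.
apply: (alternating_form_map (h := fun X : vfield M => X x)); last exact: wedge_alternating.
by move=> k X Y.
Qed.

Lemma interior_product_sum s I (t : seq I) (q : pred I) (k : I -> R)
    (P : I -> extpow (vfield M) s) (a : diff_form M) x v :
  alternating (a x) ->
  interior_product (multivector_of (\sum_(i <- t | q i) k i *: P i)) a x v
  = \sum_(i <- t | q i) k i * interior_product (multivector_of (P i)) a x v.
Proof.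
move=> aA; rewrite /interior_product.
have -> : multivector_of (\sum_(i <- t | q i) k i *: P i) x
    = \sum_(i <- t | q i) k i *: multivector_of (P i) x.
  exact: (ext_lift_sum _ _ _ _ (multivector_of_form s x)).
exact: (ext_lift_alternating_sum _ _ _ _ (alternating_catr v aA)).
Qed.

Lemma interior_product_wedge s (Q : seq (vfield M)) (a : diff_form M) x v :
  alternating (a x) -> size Q = s ->
  interior_product (multivector_of (wedge s Q)) a x v = a x (eval_fields x Q ++ v).
Proof.
move=> aA sQ; rewrite /interior_product.
have -> : multivector_of (wedge s Q) x = wedge s (eval_fields x Q).
  exact: (ext_lift_wedge _ (multivector_of_form s x)).
apply: (ext_lift_alternating_wedge (alternating_catr v aA)).
by rewrite size_map.
Qed.

Lemma interior_product_expand s (P : extpow (vfield M) s) (a : diff_form M) x v :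
  alternating (a x) ->
  interior_product (multivector_of P) a x v
  = \sum_(t <- repr P | size t.2 == s) t.1 * a x (eval_fields x t.2 ++ v).
Proof.
move=> aA; rewrite {1}[P]ext_sum_wedge interior_product_sum//.
by apply: eq_bigr => t /eqP ts; rewrite interior_product_wedge.
Qed.
End Manifold.

(** * Expansion of the terms of the formula over tuples of vector fields *)

Section Contraction.
Variables (R : realType) (n : nat) (M : manifold R n).
Local Notation V := 'rV[R]_n.

Lemma diff_form_sumE I (t : seq I) (q : pred I) (f : I -> diff_form M) x v :
  (\sum_(i <- t | q i) f i) x v = \sum_(i <- t | q i) f i x v.
Proof. by elim/big_rec2 : _ => // i _ y _ <-. Qed.

Variables (r s : nat) (alpha : diff_form M).
Hypothesis sa : smooth_form r alpha.

Lemma contract_lie_derivative_expand (P : extpow (vfield M) s) x v :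
  contract_lie_derivative P alpha x v = \sum_(t <- repr P | size t.2 == s) t.1 *
    alt_sum (fun X l => lie_derivative X alpha x (eval_fields x l ++ v)) t.2.
Proof.
rewrite /contract_lie_derivative /ext_lift diff_form_sumE.
apply: eq_bigr => t /eqP ts.
rewrite -[LHS]/(t.1 * (\sum_(i < size t.2) _ : diff_form M) x v); congr (_ * _).
rewrite diff_form_sumE; apply: eq_bigr => i _.
have lA := lie_derivative_alternating sa t.2`_i x.
have := interior_product_sum [:: tt] predT (fun _ => (-1) ^+ i)
  (fun _ => wedge s.-1 (del i t.2)) v lA.
rewrite !big_seq1 => ->; congr (_ * _).
by apply: interior_product_wedge => //; rewrite size_del// ts.
Qed.

Lemma bracket_op_expand (P : extpow (vfield M) s) x v :
  interior_product (multivector_of (bracket_op P)) alpha x v =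
  \sum_(t <- repr P | size t.2 == s) t.1 *
    \sum_(j < size t.2) \sum_(i < j) (-1) ^+ (i + j) *
      alpha x (lie_bracket t.2`_i t.2`_j x :: eval_fields x (del i (del j t.2)) ++ v).
Proof.
have aA := smooth_form_alternating sa x.
rewrite /bracket_op /ext_lift interior_product_sum//.
apply: eq_bigr => t /eqP ts; congr (_ * _).
have := interior_product_sum (index_enum 'I_(size t.2)) predT (fun _ => 1)
  (fun j : 'I_(size t.2) => \sum_(i < j)
      (-1) ^+ (i + j) *: wedge s.-1 (lie_bracket t.2`_i t.2`_j :: del i (del j t.2))) v aA.
under eq_bigr do rewrite scale1r.
move=> ->; apply: eq_bigr => j _; rewrite mul1r interior_product_sum//.
apply: eq_bigr => i _; congr (_ * _).
(* Since [i < j < s], deleting both entries and adding the bracket leaves a list of length [s.-1],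
   as [wedge s.-1] requires. *)
have js : (j < s)%N by rewrite -ts.
have s0 : (0 < s)%N by exact: leq_ltn_trans js.
have is1 : (i < s.-1)%N by rewrite -ltnS prednK// (leq_ltn_trans (ltn_ord i)).
have sd : size (del j t.2) = s.-1 by rewrite size_del// ts.
apply: interior_product_wedge => //=.
by rewrite size_del sd// prednK// (leq_ltn_trans (leq0n i)).
Qed.

(** Stated on the whole image of the chart since it is to be differentiated; [pull] undoes the
    [push] inside [vf_rep]. *)
Lemma form_rep_interior_product (P : extpow (vfield M) s) c y v :
  atlas c -> (c @` cdom c)%classic y ->
  form_rep (interior_product (multivector_of P) alpha) c y v
  = \sum_(t <- repr P | size t.2 == s) t.1 *
      form_rep alpha c y ([seq vf_rep X c y | X : vfield M <- t.2] ++ v).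
Proof.
move=> ac [z cz <-]; rewrite {1}/form_rep interior_product_expand; last first.
  exact: smooth_form_alternating sa _.
apply: eq_bigr => t _; congr (_ * _); rewrite /form_rep map_cat -map_comp.
congr (alpha _ (_ ++ _)); apply: eq_map => X /=.
by rewrite /vf_rep coordV// pull_push.
Qed.

Lemma exterior_derivative_interior_product (P : extpow (vfield M) s) x v :
  exterior_derivative (interior_product (multivector_of P) alpha) x v =
  \sum_(t <- repr P | size t.2 == s) t.1 * alt_sum (fun a l =>
    'D_a (fun y => form_rep alpha (chart_at x) y
            ([seq vf_rep X (chart_at x) y | X : vfield M <- t.2] ++ l)) (chart_at x x)) v.
Proof.
rewrite exterior_derivative_alt_sum -alt_sum_lin; apply: eq_alt_sum => a l.
(* The derivative depends on nearby values alone, and the expansion holds on the open image of the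
   chart. *)
rewrite (near_eq_derive (g := \sum_(t <- repr P | size t.2 == s) t.1 *: (fun y =>
    form_rep alpha (chart_at x) y
      ([seq vf_rep X (chart_at x) y | X : vfield M <- t.2] ++ l)))); last first.
  near=> y; rewrite form_rep_interior_product; last 2 first.
  - exact: chart_at_atlas.
  - near: y; apply: open_nbhs_nbhs; split; first exact: cimg_open.
    by exists x => //; exact: chart_at_dom.
  by rewrite fct_sumE.
have dv (Q : seq (vfield M)) : derivable (fun y => form_rep alpha (chart_at x) y
      ([seq vf_rep X (chart_at x) y | X : vfield M <- Q] ++ l)) (chart_at x x) a.
  apply: diff_derivable.
  apply: (derive_leibniz (F := fun X : vfield M => vf_rep X (chart_at x)) _ _ _ _ _).1.
  - by move=> y; exact: form_rep_alternating sa _ _.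
  - by move=> k; exact: form_rep_differentiable sa _ _.
  - move=> X; apply: vf_rep_differentiable; [exact: chart_at_atlas|exact: chart_at_dom].
rewrite -!(big_filter _ (fun t => size t.2 == s)) [in LHS]big_tnth [in RHS]big_tnth.
rewrite derive_sum.
  by apply: eq_bigr => i _; rewrite deriveZ.
by move=> i; exact: derivableZ.
Unshelve. all: by end_near. Qed.
End Contraction.

(* [P] ranges over the s-th exterior power of the real vector space of smooth
   vector fields; the equation is an equality of differential forms on M. *)
Theorem lemma3p4 (R : realType) (n r s : nat) (M : manifold R n)
    (alpha : diff_form M) (p : M -> extpow 'rV[R]_n s) (P : extpow (vfield M) s) :
  (0 < s)%N -> smooth_form r alpha -> multivector_field p ->
  multivector_of P = p ->
  interior_product p (exterior_derivative alpha)
    - (-1) ^+ s *: exterior_derivative (interior_product p alpha)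
  = contract_lie_derivative P alpha
    - interior_product (multivector_of (bracket_op P)) alpha.
Proof.
move=> _ sa _ <-; apply/funext => x; apply/funext => v.
rewrite -[LHS]/(_ x v - (-1) ^+ s * _ x v) -[RHS]/(_ x v - _ x v).
rewrite (exterior_derivative_interior_product sa) (contract_lie_derivative_expand sa).
rewrite (bracket_op_expand sa) interior_product_expand; last first.
  exact: exterior_derivative_alternating sa _.
(* All four terms now run over the same tuples of [repr P], so it suffices to compare one tuple of
   length [s]. *)
rewrite mulr_sumr -!sumrB; apply: eq_bigr => t /eqP ts.
rewrite mulrCA -!mulrBr; congr (_ * _).
(* In [chart_at x] a field is represented at [x] by its own value, which gives the goal the shape of
   [flat_cartan]. *)
have E Q : eval_fields x Q = [seq vf_rep X (chart_at x) (chart_at x x) | X : vfield M <- Q].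
  by apply: eq_map => X; rewrite vf_rep_chart_at.
rewrite exterior_derivative_alt_sum E -ts.
apply: (etrans (flat_cartan (F := fun X : vfield M => vf_rep X (chart_at x)) t.2 v
  (form_rep_alternating sa (chart_at x)) (form_rep_differentiable sa x) _)).
  move=> X; apply: vf_rep_differentiable; [exact: chart_at_atlas|exact: chart_at_dom].
congr (_ - _).
  apply: eq_alt_sum => X l; rewrite (lie_derivative_alt_sum sa) E vf_rep_chart_at.
  by congr (_ + _); apply: eq_alt_sum => a m; rewrite form_rep_chart_at.
apply: eq_bigr => j _; apply: eq_bigr => i _; congr (_ * _).
by rewrite form_rep_chart_at -E.
Qed.
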